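(* Let $t \geq 2$ and $1 \leq k_1 \leq \cdots \leq k_t$ be integers with $n = k_1 + \cdots + k_t \geq 4$, and let $X$ be a graph on $n$ vertices. Then: \begin{enumerate} \item If $t = 2$ and $k_1 \geq 2$, then $\mathsf{FS}(X, K_{k_1, n-k_1})$ is disconnected if $X$ is disconnected, is bipartite, is a cycle, or contains a $k_1$-bridge. \item If $t > 2$ and either $k_t > 2$ or $\gcd(k_1,\ldots,k_t) > 1$, then $\mathsf{FS}(X, K_{k_1,\ldots,k_t})$ is disconnected if $X$ is disconnected, is a cycle, or contains an $(n-k_t)$-bridge. \item If $t > 2$, $k_1 = 1$, and $k_t = 2$, then $\mathsf{FS}(X, K_{k_1,\ldots,k_t})$ is disconnected if $X$ is disconnected or is a path. \end{enumerate}
   Context: All graphs are simple. For graphs $X, Y$ on $n$ vertices, the friends-and-strangers graph $\mathsf{FS}(X,Y)$ has as vertices all bijections $\sigma: V(X) \to V(Y)$; two bijections $\sigma, \sigma'$ are adjacent iff there is an edge $\{a,b\} \in E(X)$ with $\{\sigma(a),\sigma(b)\} \in E(Y)$, $\sigma'(a) = \sigma(b)$, $\sigma'(b) = \sigma(a)$, and $\sigma'(c) = \sigma(c)$ for all other $c$. $K_{k_1,\ldots,k_t}$ denotes the complete $t$-partite graph with partition classes of sizes $k_1,\ldots,k_t$. A path $v_1, \ldots, v_k$ in a graph is a $k$-bridge if each edge of the path is a cut-edge, $v_2,\ldots,v_{k-1}$ have degree $2$, and $v_1, v_k$ do not have degree $1$; a single cut-vertex is a $1$-bridge. *)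

(* Defs.v *)
From HB Require Import structures.
From mathcomp Require Import all_boot.

Set Implicit Arguments.
Unset Strict Implicit.
Unset Printing Implicit Defensive.

Record sgraph := SGraph {
  vertex :> finType;
  edge : rel vertex;
  edge_sym : symmetric edge;
  edge_irrefl : irreflexive edge
}.

Definition degree (G : sgraph) (v : G) : nat := #|[set w | edge v w]|.

Definition connected (G : sgraph) : bool :=
  [forall u : G, forall v : G, connect (@edge G) u v].

Definition num_components (G : sgraph) : nat := n_comp (@edge G) predT.

Definition bipartite (G : sgraph) : Prop :=
  exists A : {set G}, forall u v : G, edge u v -> (u \in A) != (v \in A).

(* The whole graph is a cycle (resp. a path): its vertices can be listed in
   such a way that the edges are exactly the pairs of consecutive vertices. *)
Definition is_cycle (G : sgraph) : Prop :=
  exists s : seq G, [/\ 3 <= size s, uniq s, forall v : G, v \in s &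
    forall u v : G, edge u v = (next s u == v) || (next s v == u)].

Definition is_path (G : sgraph) : Prop :=
  exists s : seq G, [/\ 0 < size s, uniq s, forall v : G, v \in s &
    forall u v : G, edge u v =
      (index v s == (index u s).+1) || (index u s == (index v s).+1)].

Section Deletion.
Variable G : sgraph.

Definition del_edge_rel (u v : G) : rel G :=
  fun x y => edge x y && ([set x; y] != [set u; v]).

Lemma del_edge_sym u v : symmetric (del_edge_rel u v).
Proof. by move=> x y; rewrite /del_edge_rel edge_sym setUC. Qed.

Lemma del_edge_irrefl u v : irreflexive (del_edge_rel u v).
Proof. by move=> x; rewrite /del_edge_rel edge_irrefl. Qed.

Definition del_edge (u v : G) : sgraph :=
  SGraph (del_edge_sym u v) (del_edge_irrefl u v).

Definition del_vertex_rel (v : G) : rel {x : G | x != v} :=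
  fun x y => edge (val x) (val y).

Lemma del_vertex_sym v : symmetric (@del_vertex_rel v).
Proof. by move=> x y; apply: edge_sym. Qed.

Lemma del_vertex_irrefl v : irreflexive (@del_vertex_rel v).
Proof. by move=> x; apply: edge_irrefl. Qed.

Definition del_vertex (v : G) : sgraph :=
  SGraph (@del_vertex_sym v) (@del_vertex_irrefl v).

Definition cut_edge (u v : G) : bool :=
  edge u v && (num_components G < num_components (del_edge u v)).

Definition cut_vertex (v : G) : bool :=
  num_components G < num_components (del_vertex v).

End Deletion.

(* [behead (belast v p)] lists the interior vertices of the path [v :: p]. *)
Definition bridge (G : sgraph) (s : seq G) : bool :=
  match s with
  | [::] => false
  | [:: v] => cut_vertex v
  | v :: p =>
      [&& uniq s, path (@cut_edge G) v p,
          all (fun w => degree w == 2) (behead (belast v p)),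
          degree v != 1 & degree (last v p) != 1]
  end.

Definition has_bridge (k : nat) (G : sgraph) : Prop :=
  exists s : seq G, size s = k /\ bridge s.

Section CompleteMultipartite.
Variables (t : nat) (k : t.-tuple nat).

(* The vertex [Tagged _ j], with tag [i], is the [j]-th vertex of the [i]-th
   partition class. *)
Definition multipartite_vertex : finType := {i : 'I_t & 'I_(tnth k i)}.

Definition multipartite_rel : rel multipartite_vertex :=
  fun x y => tag x != tag y.

Lemma multipartite_sym : symmetric multipartite_rel.
Proof. by move=> x y; rewrite /multipartite_rel eq_sym. Qed.

Lemma multipartite_irrefl : irreflexive multipartite_rel.
Proof. by move=> x; rewrite /multipartite_rel eqxx. Qed.

Definition complete_multipartite : sgraph :=
  SGraph multipartite_sym multipartite_irrefl.

End CompleteMultipartite.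

Section FriendsAndStrangers.
Variables X Y : sgraph.

Definition bijection : finType :=
  {f : {ffun X -> Y} | injectiveb f && [forall y, y \in codom f]}.

Definition fs_rel : rel bijection := fun s s' =>
  [exists a, exists b,
    [&& edge a b, edge (val s a) (val s b),
        val s' a == val s b, val s' b == val s a &
        [forall c, (c != a) && (c != b) ==> (val s' c == val s c)]]].

Lemma fs_sym : symmetric fs_rel.
Proof.
suff H s s' : fs_rel s s' -> fs_rel s' s by move=> s s'; apply/idP/idP; apply: H.
case/existsP=> a /existsP[b /and5P[ab sab /eqP s'a /eqP s'b /forallP s'c]].
apply/existsP; exists a; apply/existsP; exists b.
rewrite ab s'a s'b edge_sym sab !eqxx /=.
by apply/forallP=> c; rewrite [val s c == _]eq_sym; apply: s'c.
Qed.

Lemma fs_irrefl : irreflexive fs_rel.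
Proof.
move=> s; apply/existsP=> -[a /existsP[b /and5P[_ sab /eqP sa _ _]]].
by rewrite sa edge_irrefl in sab.
Qed.

Definition FS : sgraph := SGraph fs_sym fs_irrefl.

End FriendsAndStrangers.

(* Main.v *)
(* Read a vertex of FS(X,Y) as an arrangement of the people (vertices of [Y])
   at the places (vertices of [X]). In each case some function of the
   arrangement is preserved by all legal swaps but not by all permutations:
   - [X] disconnected: the set of people located in a fixed component;
   - [X] and [Y] bipartite with [A], [B] as sides: the sign of the arrangement
     times the parity of the number of people of [B] located in [A];
   - [X] a path: which of two members of the same part comes first;
   - [X] a cycle: the parity of the number of inversions among well-chosen pairs
     taken inside the parts, namely the three sides of a triangle in a part of
     size at least 3, or all the parts if they are pairs;
   - [X] with an [m]-bridge, where [m] people lie outside the part [I]: if [l]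
     places lie on the left of the bridge, the set of the [l] leftmost members
     of [I], which makes sense because members of [I] cannot pass one another
     on the bridge. On either side, the number of outsiders off the bridge
     equals the number of members of [I] that belong to that side but stand on
     the bridge, so whoever steps off the bridge does so on their own side. *)
Require Import Defs.
From HB Require Import structures.
From mathcomp Require Import all_boot all_fingroup.
From mathcomp Require Import zify.

Set Implicit Arguments.
Unset Strict Implicit.
Unset Printing Implicit Defensive.

(** * Invariants of arrangements *)

Section Arrangements.
Variables X Y : sgraph.
Hypothesis card_eq : #|Y| = #|X|.

(** Arrangements are recorded as maps from people to places, so that exchanging two people is
    precomposition with a transposition. *)
Definition swap (g : {ffun Y -> X}) (p q : Y) : {ffun Y -> X} :=
  [ffun y => g (tperm p q y)].

Lemma swap_inj (g : {ffun Y -> X}) p q : injective g -> injective (swap g p q).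
Proof. by move=> gI y z; rewrite !ffunE => /gI /perm_inj. Qed.

Lemma swapK (g : {ffun Y -> X}) p q : swap (swap g p q) p q = g.
Proof. by apply/ffunP=> y; rewrite !ffunE tpermK. Qed.

Lemma swapC (g : {ffun Y -> X}) p q : swap g p q = swap g q p.
Proof. by rewrite /swap tpermC. Qed.

Lemma bijection_val_inj (s : bijection X Y) : injective (val s).
Proof. by case: s => f /= /andP[/injectiveP]. Qed.

Lemma bijection_surj (s : bijection X Y) y : exists x, val s x == y.
Proof.
case: s => f /= /andP[_ /forallP /(_ y) /codomP[x ->]].
by exists x.
Qed.

Definition inverse (s : bijection X Y) : {ffun Y -> X} :=
  [ffun y => xchoose (bijection_surj s y)].

Lemma inverseK (s : bijection X Y) y : val s (inverse s y) = y.
Proof. by rewrite ffunE; apply/eqP; apply: (xchooseP (bijection_surj s y)). Qed.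

Lemma inverse_eq (s : bijection X Y) x y : val s x = y -> inverse s y = x.
Proof. by move=> sx; apply: (@bijection_val_inj s); rewrite inverseK sx. Qed.

Lemma inverse_inj (s : bijection X Y) : injective (inverse s).
Proof. by apply: (can_inj (g := val s)) => y; apply: inverseK. Qed.

Lemma exists_inverse (g : {ffun Y -> X}) :
  injective g -> exists s, inverse s = g.
Proof.
move=> gI; have gS x : exists y, g y == x.
  have [h gh hg] : bijective g by apply: inj_card_bij; rewrite ?card_eq.
  by exists (h x); rewrite hg.
pose f : {ffun X -> Y} := [ffun x => xchoose (gS x)].
have fK x : g (f x) = x.
  by rewrite ffunE; apply/eqP; apply: (xchooseP (gS x)).
have gK y : f (g y) = y by apply: gI; rewrite fK.
have fB : injectiveb f && [forall y, y \in codom f].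
  apply/andP; split; first by apply/injectiveP; apply: can_inj fK.
  by apply/forallP=> y; rewrite -[y]gK codom_f.
exists (exist _ f fB).
by apply/ffunP=> y; apply: inverse_eq; rewrite /= gK.
Qed.

(** On inverse maps an edge of [FS X Y] is a legal swap, so [J] is constant along walks and
    separates [g0] from [swap g0 p0 q0]. *)
Lemma fs_disconnected (T : eqType) (J : {ffun Y -> X} -> T) (g0 : {ffun Y -> X}) p0 q0 :
    (forall (g : {ffun Y -> X}) p q, injective g -> edge p q -> edge (g p) (g q) ->
       J (swap g p q) = J g) ->
    injective g0 -> J (swap g0 p0 q0) != J g0 ->
  ~~ connected (FS X Y).
Proof.
move=> Jinv g0I; apply: contra => /forallP Con.
have [s' <-] := exists_inverse (swap_inj (p := p0) (q := q0) g0I).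
have [s <-] := exists_inverse g0I.
have /connectP[w sw ->] := forallP (Con s) s'.
elim: w s sw => //= s1 w IHw s /andP[ss1 /IHw] /eqP ->.
case/existsP: ss1 => a /existsP[b /and5P[ab sab /eqP s1a /eqP s1b /forallP s1c]].
suff -> : inverse s1 = swap (inverse s) (val s a) (val s b).
  apply/eqP; apply: Jinv => //; first exact: inverse_inj.
  by rewrite !(inverse_eq (erefl _)).
apply/ffunP=> y; rewrite [RHS]ffunE; apply: inverse_eq.
case: tpermP => [->|->|/eqP ya /eqP yb].
- by rewrite (inverse_eq (erefl _)).
- by rewrite (inverse_eq (erefl _)).
move: (s1c (inverse s y)).
rewrite (contra_neq _ ya) ?(contra_neq _ yb) /=.
- by move/eqP->; rewrite inverseK.
- by move<-; rewrite inverseK.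
by move<-; rewrite inverseK.
Qed.

Lemma exists_arrangement : exists g : {ffun Y -> X}, injective g.
Proof.
exists [ffun y => enum_val (cast_ord card_eq (enum_rank y))] => y z.
by rewrite !ffunE => /enum_val_inj /cast_ord_inj /enum_rank_inj.
Qed.

Lemma exists_arrangement2 (y1 y2 : Y) (x1 x2 : X) : y1 != y2 -> x1 != x2 ->
  exists g : {ffun Y -> X}, [/\ injective g, g y1 = x1 & g y2 = x2].
Proof.
move=> y12 x12; have [g gI] := exists_arrangement.
pose g1 y := tperm (g y1) x1 (g y).
have g1I : injective g1 by move=> y z /perm_inj /gI.
have g1y1 : g1 y1 = x1 by rewrite /g1 tpermL.
(* The second transposition fixes [x1], because neither [g1 y2] nor [x2] equals [x1]. *)
exists [ffun y => tperm (g1 y2) x2 (g1 y)]; split.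
- by move=> y z; rewrite !ffunE => /perm_inj /g1I.
- rewrite ffunE tpermD // g1y1 1?eq_sym //.
  by apply: contra_neq y12; rewrite -{1}g1y1 => /g1I.
by rewrite ffunE tpermL.
Qed.

(** * Disconnected and bipartite graphs of places *)

Lemma disconnected_FS : 1 < #|Y| -> ~~ connected X -> ~~ connected (FS X Y).
Proof.
move=> /card_gt1P[y1 [y2 [_ _ y12]]].
case/forallPn=> x1 /forallPn[x2 x12].
have [|g [gI gy1 gy2]] := exists_arrangement2 (x1 := x1) (x2 := x2) y12.
  by apply: contra x12 => /eqP ->; apply: connect0.
apply: (@fs_disconnected _
  (fun g => [set y | connect (@edge X) x1 (g y)]) g y1 y2) => //.
- move=> h p q _ _ /connect1 hpq; apply/setP=> y; rewrite !inE ffunE.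
  have cs : connect_sym (@edge X) by apply: sym_connect_sym; apply: edge_sym.
  by case: tpermP => // ->; rewrite (same_connect_r cs hpq).
apply/eqP=> /setP /(_ y1); rewrite !inE ffunE tpermL gy1 gy2 connect0.
by rewrite (negbTE x12).
Qed.

(** A legal swap is odd and moves exactly one member of [B] into or out of [A], so both parities
    flip; exchanging two members of [B] flips only the sign. *)
Lemma bipartite_FS (B : {set Y}) :
    (forall p q : Y, edge p q -> (p \in B) != (q \in B)) ->
    1 < #|B| -> bipartite X ->
  ~~ connected (FS X Y).
Proof.
move=> BY /card_gt1P[b1 [b2 [b1B b2B b12]]] [A AX].
have [g gI] := exists_arrangement.
have [h hI] : exists h : {ffun X -> Y}, injective h.
  by have [s _] := exists_inverse gI; exists (val s); apply: bijection_val_inj.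
(* The injection [h] turns an arrangement into a permutation of [Y], which has a sign; the default
   is taken only for maps that are not injective. *)
pose sgn (f : {ffun Y -> X}) : {perm Y} := insubd (1%g : {perm Y}) [ffun y => h (f y)].
have sgn_swap (f : {ffun Y -> X}) p q : injective f -> p != q ->
    odd_perm (sgn (swap f p q)) = ~~ odd_perm (sgn f).
  move=> fI pq; have sgnE (f1 : {ffun Y -> X}) : injective f1 -> sgn f1 =1 h \o f1.
    move=> f1I y; rewrite -pvalE [pval _]val_insubd /=.
    case: ifP => [_|/injectiveP[]]; first by rewrite ffunE.
    by move=> u v; rewrite !ffunE => /hI /f1I.
  have -> : sgn (swap f p q) = (tperm p q * sgn f)%g.
    apply/permP=> y; rewrite permM !sgnE //; last exact: swap_inj.
    by rewrite /= ffunE.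
  by rewrite odd_permM odd_tperm pq.
pose inAB (f : {ffun Y -> X}) := [set y in B | f y \in A].
apply: (@fs_disconnected _ (fun f => odd_perm (sgn f) (+) odd #|inAB f|) g b1 b2)
  => //.
  move=> f p q fI pq fpq.
  have npq : p != q by apply: contraTneq pq => ->; rewrite edge_irrefl.
  rewrite sgn_swap //.
  have wlg (f1 : {ffun Y -> X}) (a b : Y) :
      a \in B -> b \notin B -> f1 b \notin A -> f1 a \in A ->
      odd #|inAB f1| = ~~ odd #|inAB (swap f1 a b)|.
    move=> aB bB fbA faA; rewrite (cardsD1 a) inE aB faA /=; congr (~~ odd _).
    apply: eq_card => y; rewrite !inE ffunE; case: tpermP => [->|->|].
    - by rewrite eqxx (negbTE fbA) andbF.
    - by rewrite (negbTE bB) andbF.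
    by move=> /eqP ->.
  have wlg2 (a b : Y) : a \in B -> b \notin B -> (f a \in A) != (f b \in A) ->
      odd #|inAB f| = ~~ odd #|inAB (swap f a b)|.
    move=> aB bB; case: (boolP (f a \in A)) => faA; case: (boolP (f b \in A)) => fbA // _.
      exact: wlg.
    have := wlg (swap f a b) a b aB bB; rewrite swapK !ffunE tpermL tpermR => -> //.
    by rewrite negbK.
  move: (BY _ _ pq) (AX _ _ fpq).
  case: (boolP (p \in B)) => pB; case: (boolP (q \in B)) => qB // _ fA.
    by rewrite (wlg2 p q) //; case: (odd_perm _); case: (odd _).
  rewrite (wlg2 q p) 1?eq_sym // (swapC f q p).
  by case: (odd_perm _); case: (odd _).
rewrite sgn_swap //.
suff -> : #|inAB (swap g b1 b2)| = #|inAB g| by case: (odd_perm _); case: (odd _).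
rewrite -(card_imset _ (@perm_inj _ (tperm b1 b2))).
apply: eq_card => y; apply/imsetP/idP => [[z]|].
  rewrite !inE ffunE => /andP[zB zA] ->; rewrite zA andbT.
  by case: tpermP.
rewrite inE => /andP[yB yA]; exists (tperm b1 b2 y); last by rewrite tpermK.
by rewrite inE ffunE tpermK yA andbT; case: tpermP.
Qed.

End Arrangements.

(** * Paths and cycles *)

Section LinearOrder.
Variables (T : finType) (P : T -> nat).
Hypothesis PI : injective P.

(** No value of [P] lies strictly between [P p] and [P q], so only the comparison of [p] with [q]
    could change. *)
Lemma swap_consecutive_ltn (p q y z : T) :
    P q = (P p).+1 -> y != z -> ~~ ((y \in pred2 p q) && (z \in pred2 p q)) ->
  (P (tperm p q y) < P (tperm p q z)) = (P y < P z).
Proof.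
move=> Ppq yz.
have PE u v : (u == v) = (P u == P v) by rewrite inj_eq.
rewrite !inE !PE in yz *.
case: tpermP => [->|->|/eqP + /eqP +]; case: tpermP => [->|->|/eqP + /eqP +];
  rewrite ?PE; clear PE PI; lia.
Qed.

(** Moving an element from one extreme to the other reverses its comparison with every third
    element. *)
Lemma swap_extremes_ltn (p q y z : T) :
    P p = 0 -> (forall u, P u <= P q) -> y != z ->
    ~~ ((y \in pred2 p q) && (z \in pred2 p q)) ->
  (P (tperm p q y) < P (tperm p q z)) =
    (P y < P z) (+) ((y \in pred2 p q) (+) (z \in pred2 p q)).
Proof.
move=> P0 Pmax yz.
have PE u v : (u == v) = (P u == P v) by rewrite inj_eq.
move: (Pmax y) (Pmax z); rewrite !inE !PE in yz *.
case: tpermP => [->|->|/eqP + /eqP +]; case: tpermP => [->|->|/eqP + /eqP +];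
  rewrite ?PE; clear PE PI Pmax; last 1 first.
  by do 4!move=> /negbTE ->; rewrite addbF.
all: lia.
Qed.

End LinearOrder.

Section LinearInvariants.
Variables X Y : sgraph.
Hypothesis card_eq : #|Y| = #|X|.

(** [y1] and [y2] never swap with each other, and a swap of two consecutive people preserves every
    other comparison of positions. *)
Lemma path_FS (y1 y2 : Y) :
  y1 != y2 -> ~~ edge y1 y2 -> is_path X -> ~~ connected (FS X Y).
Proof.
move=> y12 ny12 [s [_ _ sX sE]].
have [g gI] := exists_arrangement card_eq.
have posI (f : {ffun Y -> X}) : injective f -> injective (fun y => index (f y) s).
  by move=> fI y z /= e; apply: fI; rewrite -(nth_index (f y) (sX (f y))) e nth_index.
apply: (@fs_disconnected _ _ card_eq _
  (fun g => index (g y1) s < index (g y2) s) g y1 y2) => //.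
- move=> f p q /posI fI pq; have nh : ~~ ((y1 \in pred2 p q) && (y2 \in pred2 p q)).
    apply: contra ny12 => /andP[]; rewrite !inE => /orP[]/eqP y1E /orP[]/eqP y2E.
    - by rewrite y1E y2E eqxx in y12.
    - by rewrite y1E y2E.
    - by rewrite y1E y2E edge_sym.
    by rewrite y1E y2E eqxx in y12.
  rewrite sE !ffunE => /orP[/eqP pqE|/eqP qpE].
    exact: (swap_consecutive_ltn fI).
  by rewrite !(tpermC p q); apply: (swap_consecutive_ltn fI) => //; rewrite andbC;
    move: nh; rewrite !inE; lia.
rewrite !ffunE tpermL tpermR.
have : index (g y1) s != index (g y2) s by apply: contra_neq y12 => /(posI _ gI).
lia.
Qed.

Lemma next_index (T : eqType) (s : seq T) x : uniq s -> x \in s ->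
  index (next s x) s = (index x s).+1 \/
  index (next s x) s = 0 /\ (index x s).+1 = size s.
Proof.
case: s => // y s us xs; rewrite next_nth xs.
have /= := index_mem x (y :: s); rewrite xs -/(index x (y :: s)).
set i := index x (y :: s); rewrite ltnS leq_eqVlt => /orP[/eqP iE|iE].
  (* Here [x] is last, and [nth] returns its default [y], the head of the cycle. *)
  by right; rewrite nth_default ?iE //= eqxx.
by left; rewrite -(index_uniq y (i := i.+1) _ us).
Qed.

Definition order_parity (r : seq (Y * Y)) (P : Y -> nat) : bool :=
  \big[addb/false]_(e <- r) (P e.1 < P e.2).

(* A swap across the edge closing the cycle moves [p] from the first position
   to the last one, and [q] from the last to the first, so it reverses exactly
   the pairs of [r] that contain [p] or [q]; the other swaps reverse none. *)
Lemma cycle_FS (r : seq (Y * Y)) (a b : Y) :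
    (forall e, e \in r -> e.1 != e.2 /\ ~~ edge e.1 e.2) ->
    (forall p q, edge p q ->
       \big[addb/false]_(e <- r)
          ((e.1 \in pred2 p q) (+) (e.2 \in pred2 p q)) = false) ->
    (forall P : Y -> nat, injective P ->
       order_parity r (fun y => P (tperm a b y)) != order_parity r P) ->
  is_cycle X -> ~~ connected (FS X Y).
Proof.
move=> rY rpar rab [s [_ us sX sE]].
have [g gI] := exists_arrangement card_eq.
have posI (f : {ffun Y -> X}) : injective f -> injective (fun y => index (f y) s).
  by move=> fI y z /= e; apply: fI; rewrite -(nth_index (f y) (sX (f y))) e nth_index.
pose J (f : {ffun Y -> X}) := order_parity r (fun y => index (f y) s).
have JE f p q : J (swap f p q) =
    order_parity r (fun y => index (f (tperm p q y)) s).
  by apply: eq_bigr => e _; rewrite !ffunE.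
apply: (@fs_disconnected _ _ card_eq _ J g a b) => //; last first.
  by rewrite JE; apply: rab (posI _ gI).
have nh (p q : Y) e : edge p q -> e \in r ->
    ~~ ((e.1 \in pred2 p q) && (e.2 \in pred2 p q)).
  move=> pq /rY[e12]; apply: contra; rewrite !inE.
  case/andP=> /orP[]/eqP e1 /orP[]/eqP e2; rewrite e1 e2 ?eqxx // in e12 *.
  by rewrite edge_sym.
have wlg (f : {ffun Y -> X}) p q : injective f -> edge p q ->
    next s (f p) = f q -> J (swap f p q) = J f.
  move=> fI pq fpq; have [|] := next_index us (sX (f p)); rewrite fpq.
    move=> idx; rewrite JE; apply: eq_big_seq => e er.
    apply: (swap_consecutive_ltn (posI _ fI)) => //; last exact: nh.
    by case: (rY e er).
  (* At the closing edge [q] is first and [p] is last; the reversals cancel modulo 2 by [rpar]. *)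
  case=> q0 pmax; rewrite swapC JE /J /order_parity.
  transitivity (\big[addb/false]_(e <- r) ((index (f e.1) s < index (f e.2) s) (+)
      ((e.1 \in pred2 q p) (+) (e.2 \in pred2 q p)))); last first.
    by rewrite big_split /= rpar ?addbF // edge_sym.
  apply: eq_big_seq => e er.
  apply: (swap_extremes_ltn (posI _ fI)) => //.
  - by move=> u; rewrite -ltnS pmax index_mem.
  - by case: (rY e er).
  by apply: nh; rewrite 1?edge_sym.
move=> f p q fI pq; rewrite sE => /orP[]/eqP; first exact: wlg.
by rewrite swapC; apply: wlg; rewrite 1?edge_sym.
Qed.

(** Each corner lies on two sides, so a legal swap reverses an even number of sides; with the cyclic
    orientation, exchanging [a] and [b] reverses all three. *)
Lemma cycle_triangle_FS (a b c : Y) : uniq [:: a; b; c] ->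
    ~~ edge a b -> ~~ edge b c -> ~~ edge a c ->
  is_cycle X -> ~~ connected (FS X Y).
Proof.
rewrite /= !inE negb_or !andbT => /andP[/andP[ab ac] bc] eab ebc eac.
apply: (@cycle_FS [:: (a, b); (b, c); (c, a)] a b).
- move=> e; rewrite !inE => /or3P[] /eqP -> //=.
  by rewrite eq_sym edge_sym.
- move=> p q _; rewrite !big_cons big_nil /fst /snd.
  by case: (a \in _); case: (b \in _); case: (c \in _).
move=> P PI; rewrite /order_parity !big_cons !big_nil /=.
rewrite tpermL tpermR tpermD //.
have PE u v : (P u == P v) = (u == v) by apply: inj_eq.
by rewrite -!PE in ab ac bc; clear PE PI; lia.
Qed.

End LinearInvariants.

(** Adjacent people belong to different pairs, so a swap across the closing edge reverses two pairs;
    exchanging the members of one pair reverses that pair alone. *)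
Lemma matching_cycle_FS (t : nat) (k : t.-tuple nat) (X : sgraph) :
    #|complete_multipartite k| = #|X| -> 0 < t ->
    (forall i, tnth k i = 2) -> is_cycle X ->
  ~~ connected (FS X (complete_multipartite k)).
Proof.
move=> card_eq t_gt0 k2.
have k0 i : 0 < tnth k i by rewrite k2.
have k1 i : 1 < tnth k i by rewrite k2.
pose e0 i : complete_multipartite k := Tagged (fun i => 'I_(tnth k i)) (Ordinal (k0 i)).
pose e1 i : complete_multipartite k := Tagged (fun i => 'I_(tnth k i)) (Ordinal (k1 i)).
have e01 i j : e0 i != e1 j.
  apply/eqP=> e; have ij : i = j by have := congr1 tag e.
  by subst j; have := congr1 val (eq_from_Tagged e).
have eE y : y = e0 (tag y) \/ y = e1 (tag y).
  case: y => i j; have [|] : val j = 0 \/ val j = 1.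
  - by have /= := leq_trans (ltn_ord j) (eq_leq (k2 i)); lia.
  - by left; congr existT; apply: val_inj.
  - by right; congr existT; apply: val_inj.
have in_pred2 (p q : complete_multipartite k) i : tag p != tag q ->
    (e0 i \in pred2 p q) (+) (e1 i \in pred2 p q) =
    (i == tag p) (+) (i == tag q).
  have e0E j l : (e0 j == e0 l) = (j == l).
    by apply/eqP/eqP => [e|->//]; have := congr1 tag e.
  have e1E j l : (e1 j == e1 l) = (j == l).
    by apply/eqP/eqP => [e|->//]; have := congr1 tag e.
  have e10 j l : (e1 j == e0 l) = false by rewrite eq_sym (negbTE (e01 l j)).
  rewrite !inE => pq; have := pq.
  have [->|->] := eE p; have [->|->] := eE q;
    rewrite /= ?e0E ?e1E ?e10 ?(negbTE (e01 _ _)) ?orbF ?addbF ?addFb //=.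
  - by move/negbTE => {}pq; case: (eqVneq i (tag p)) => [->|_] //; rewrite pq.
  - by rewrite addbC.
  - by move/negbTE => {}pq; case: (eqVneq i (tag p)) => [->|_] //; rewrite pq.
pose i0 := Ordinal t_gt0.
apply: (@cycle_FS _ _ card_eq [seq (e0 i, e1 i) | i <- enum 'I_t] (e0 i0) (e1 i0)).
- by move=> e /mapP[i _ ->]; rewrite e01 /= /multipartite_rel /= eqxx.
- move=> p q pq; rewrite big_map big_enum /=.
  under eq_bigr => i _ do rewrite in_pred2 //.
  rewrite big_split /= (bigD1 (tag p)) //= eqxx big1 => [|i /negbTE //].
  by rewrite (bigD1 (tag q)) //= eqxx big1 => [|i /negbTE //].
have orderE P : order_parity [seq (e0 i, e1 i) | i <- enum 'I_t] P =
    \big[addb/false]_i (P (e0 i) < P (e1 i)).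
  by rewrite /order_parity big_map big_enum.
move=> P PI; rewrite !orderE.
rewrite (bigD1 i0) //= [in X in _ != X](bigD1 i0) //= tpermL tpermR.
set S := (X in _ (+) X != _); set S' := (X in _ != _ (+) X).
have -> : S = S'.
  apply: eq_bigr => i ni; have tg j (y : complete_multipartite k) :
    tag y != j -> tperm (e0 j) (e1 j) y = y.
    by move=> yj; apply: tpermD; apply: contra_neq yj => <-.
  by rewrite !tg.
have : P (e0 i0) != P (e1 i0) by rewrite inj_eq.
by clear; case: S'; lia.
Qed.

(** * Bridges *)

Section Bridges.
Variable X : sgraph.

(** If [u] and [v] stayed connected, deleting the edge would leave connectivity, hence the number of
    components, unchanged. *)
Lemma cut_edge_connectN (u v : X) :
  cut_edge u v -> ~~ connect (@edge (del_edge u v)) u v.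
Proof.
case/andP=> uv; apply: contraTN => cuv.
have cs : connect_sym (@edge (del_edge u v)).
  by apply: sym_connect_sym; apply: edge_sym.
suff eqc : connect (@edge (del_edge u v)) =2 connect (@edge X).
  by rewrite /num_components (eq_n_comp eqc) ltnn.
move=> x y; apply/idP/idP; apply: connect_sub => {}x {}y.
  by case/andP=> /connect1.
move=> xy; have [e|ne] := eqVneq [set x; y] [set u; v]; last first.
  by apply: connect1; rewrite /= /del_edge_rel xy ne.
have /set2P xuv : x \in [set u; v] by rewrite -e set21.
have /set2P yuv : y \in [set u; v] by rewrite -e set22.
case: xuv yuv => -> [] ->; rewrite ?connect0 //.
by have := cs u v; rewrite cuv.
Qed.

Lemma degree2_neighbours (x a b w : X) : degree x = 2 -> a != b ->
  edge x a -> edge x b -> edge x w -> w = a \/ w = b.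
Proof.
move=> dx ab xa xb xw; apply/set2P.
suff -> : [set a; b] = [set w | edge x w] by rewrite inE.
apply/eqP; rewrite eqEcard cards2 ab -/(degree x) dx andbT.
by apply/subsetP=> y /set2P[] ->; rewrite inE.
Qed.

Lemma other_neighbour (x a : X) : degree x != 1 -> edge x a ->
  exists2 w, edge x w & w != a.
Proof.
move=> dx xa; have /card_gt1P[b [c [xb xc bc]]] : 1 < degree x.
  by rewrite /degree ltn_neqAle eq_sym dx /=; apply/card_gt0P; exists a; rewrite inE.
rewrite !inE in xb xc.
by have [bE|] := eqVneq b a; [exists c; rewrite // -bE eq_sym | exists b].
Qed.

(* [d] is the position along the bridge: 0 on its left, [i] at [v_i], and
   [k.+1] on its right. *)
Lemma bridge_depth (k : nat) (s : seq X) : 1 < k -> size s = k -> bridge s ->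
  exists d : X -> nat,
    [/\ forall u v : X, edge u v -> d u <= (d v).+1,
        forall u v : X, 0 < d u <= k -> d u = d v -> u = v,
        k <= #|[set u | 0 < d u <= k]|, forall u, d u <= k.+1
      & (exists u, d u = 0) /\ exists u, d u = k.+1].
Proof.
case: s => [|v1 [|v2 p]] k1; [by move=> /= k0; lia | by move=> /= k0; lia |].
set s := v1 :: v2 :: p => sk /and5P[us sp int deg1 degk].
have v12 : cut_edge v1 v2 by case/andP: sp.
have nc12 := cut_edge_connectN v12.
set D := @edge _ in nc12; have cs : connect_sym D.
  by apply: sym_connect_sym; apply: edge_sym.
(* Indices start at 0: the bridge runs from [v 0], at depth 1, to [v k.-1], at depth [k]. *)
pose v i := nth v1 s i.
have vidx i : i < k -> index (v i) s = i by move=> ik; rewrite index_uniq ?sk.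
have vinj i j : v i = v j -> i < k -> j < k -> i = j.
  by move=> e ik jk; rewrite -(vidx i) // e vidx.
have vE x : x \in s -> exists2 i, i < k & x = v i.
  by move=> xs; exists (index x s); rewrite ?/v ?nth_index // -sk index_mem.
have vs i : i < k -> v i \in s by move=> ik; rewrite mem_nth ?sk.
have vedge i : i.+1 < k -> edge (v i) (v i.+1).
  move=> ik; have /(pathP v1)/(_ i) := sp.
  by rewrite -ltnS -[(size _).+1]/(size s) sk => /(_ ik)/andP[].
have lastE : last v1 (v2 :: p) = v k.-1 by rewrite -sk /v nth_last.
have vint i : 0 < i -> i < k.-1 -> degree (v i) = 2.
  move=> i0 ik; apply/eqP; move/allP: int; apply.
  have -> : v i = nth v1 (behead (belast v1 (v2 :: p))) i.-1.
    rewrite nth_behead prednK // /v /s (lastI v1 (v2 :: p)) nth_rcons size_belast.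
    by rewrite -ltnS -[(size _).+1]/(size s) sk; have -> : i.+1 < k by lia.
  by apply: mem_nth; rewrite size_behead size_belast /=; move: sk => /=; lia.
have nbr i w : 0 < i -> i < k.-1 -> edge (v i) w -> w = v i.-1 \/ w = v i.+1.
  move=> i0 ik; apply: degree2_neighbours; first exact: vint.
  - by apply/eqP=> /vinj; lia.
  - by rewrite edge_sym -[in X in edge _ X](prednK i0); apply: vedge; lia.
  - by apply: vedge; lia.
have v1D w : edge v1 w -> w != v2 -> connect D v1 w.
  move=> v1w wv2; apply: connect1; rewrite /D /= /del_edge_rel v1w /=.
  apply: contra_neq wv2 => e; have : w \in [set v1; v2] by rewrite -e set22.
  by case/set2P=> // wv1; rewrite wv1 edge_irrefl in v1w.
have edgeD x y : x != v1 -> y != v1 -> edge x y -> connect D x y.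
  move=> xv1 yv1 xy; apply: connect1; rewrite /D /= /del_edge_rel xy /=.
  apply/eqP=> e; have : v1 \in [set x; y] by rewrite e set21.
  by case/set2P=> e1; rewrite e1 eqxx in xv1 yv1.
have vneq i : 0 < i -> i < k -> v i != v1.
  by move=> i0 ik; apply/eqP=> /(@vinj i 0); lia.
(* The later bridge edges avoid [v1], so they survive the deletion and keep the rest of the bridge
   on the side of [v2]. *)
have nc i : 0 < i -> i < k -> ~~ connect D v1 (v i).
  elim: i => // -[_ _ //|i IHi] _ ik.
  rewrite -(same_connect_r cs (edgeD (v i.+1) _ _ _ _)) ?IHi ?vneq //; [lia.. |].
  by apply: vedge.
have Dout x y : x != v1 -> y != v1 -> edge x y -> connect D v1 x = connect D v1 y.
  by move=> xv1 yv1 xy; apply: (same_connect_r cs); apply: edgeD.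
have v1s : v1 \in s by rewrite mem_head.
have outv1 x : x \notin s -> x != v1 by apply: contraNneq => ->.
have outv2 x : x \notin s -> x != v2.
  by apply: contraNneq => ->; rewrite inE mem_head orbT.
have mid_out i w : 0 < i -> i < k.-1 -> w \notin s -> ~~ edge (v i) w.
  move=> i0 ik; apply: contra => /nbr[] // ->; apply: vs; lia.
(* Off the bridge, deleting its first edge decides the side: places still reachable from [v1] are on
   the left, all others, including any other component of [X], on the right. *)
exists (fun x => if x \in s then (index x s).+1 else
                 if connect D v1 x then 0 else k.+1); split.
- move=> x y xy.
  have [xs|xs] := boolP (x \in s); have [ys|ys] := boolP (y \in s).
  + have [i ik xE] := vE x xs; have [j jk yE] := vE y ys.
    (* An edge skipping part of the bridge would give an interior vertex a third neighbour or
       reconnect [v1] with the far end. *)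
    subst x y; rewrite !vidx //; rewrite !ltnS leqNgt; apply/negP=> ji.
    have [j0|j0] := posnP j.
      have [ik1|ik1] := ltnP i k.-1.
        case: (nbr i (v j) _ ik1 xy) => [|/vinj|/vinj]; lia.
      move: xy; rewrite edge_sym j0 => /v1D cv.
      have := nc i; rewrite cv; first by move=> H; suff: false by []; apply: H; lia.
      by apply/eqP=> /(@vinj i 1); lia.
    by rewrite edge_sym in xy; case: (nbr j (v i) j0 _ xy) => [|/vinj|/vinj]; lia.
  + have [i ik xE] := vE x xs; subst x; rewrite vidx //.
    case: ifP => [cy|_]; last lia.
    have [->//|i0] := posnP i.
    have := nc i i0 ik; rewrite (Dout _ y) ?vneq ?outv1 // cy //.
  + have [j jk yE] := vE y ys; subst y; rewrite vidx //.
    case: ifP => // /negbT ncx; rewrite !ltnS.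
    have [j0|j0] := posnP j.
      by case/negP: ncx; apply: v1D; rewrite ?outv2 // edge_sym; move: xy; rewrite j0.
    have [jk1|] := ltnP j k.-1; last lia.
    by have := mid_out j x j0 jk1 xs; rewrite edge_sym xy.
  by rewrite (Dout x y) ?outv1 //; case: ifP.
- move=> x y; have [xs|xs] := boolP (x \in s); last by case: ifP => //; lia.
  move=> xk; have [ys|ys] := boolP (y \in s); last by case: ifP => //; lia.
  by move=> /succn_inj e; rewrite -(nth_index v1 xs) e nth_index.
- rewrite -[X in X <= _]sk -(card_uniqP us); apply/subset_leq_card/subsetP=> x xs.
  by rewrite inE xs ltnS leq0n -sk index_mem.
- move=> x; case: ifP => [xs|_]; last by case: ifP.
  by have := index_mem x s; rewrite xs sk; lia.
split.
  (* The left end is not a leaf, so it has a neighbour besides [v2]; this neighbour is off the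
     bridge, at depth 0. *)
  have [w v1w wv2] := other_neighbour deg1 (vedge 0 k1).
  exists w; have cw := v1D w v1w wv2; rewrite cw.
  case: ifP => // /vE[[|i] ik wE]; first by move: v1w; rewrite wE /v /= edge_irrefl.
  by have := nc i.+1 isT ik; rewrite -wE cw.
rewrite lastE in degk.
have [|w vw wv] := @other_neighbour (v k.-1) (v k.-2) degk.
  have k2 : k.-2.+1 = k.-1 by lia.
  by rewrite edge_sym -[in X in edge _ X]k2; apply: vedge; lia.
(* A second neighbour of the right end is off the bridge, since an edge back to [v1] would bypass
   the first edge and interior vertices have no room for it. *)
have ws : w \notin s.
  apply/negP=> /vE[j jk wE]; subst w.
  have [j0|j0] := posnP j.
    have := nc k.-1; rewrite v1D; [lia | by rewrite edge_sym -[v1]/(v 0) -j0 |].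
    apply/eqP=> /(@vinj k.-1 1) k2; case/eqP: wv; congr v; lia.
  have [jk1|jk1] := ltnP j k.-1.
    rewrite edge_sym in vw; case: (nbr j _ j0 jk1 vw) => /vinj e; first lia.
    by case/eqP: wv; congr v; lia.
  by have jE : j = k.-1; [lia | rewrite jE edge_irrefl in vw].
have [kp0 kpk] : 0 < k.-1 /\ k.-1 < k by lia.
have := nc _ kp0 kpk; rewrite (Dout _ w (vneq _ kp0 kpk) (outv1 _ ws) vw) => /negbTE ncw.
by exists w; rewrite (negbTE ws) ncw.
Qed.
End Bridges.

(** * The invariant carried by an independent set across a bridge *)

Section BridgeInvariant.
Variables X Y : sgraph.
Hypothesis card_eq : #|Y| = #|X|.

(* The invariant is the set of the [l] leftmost members of [I], where [l] is
   the number of vertices at depth 0. *)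
Lemma depth_FS (I : {set Y}) (k : nat) (d : X -> nat) :
    #|I| + k = #|X| -> {in I &, forall p q, ~~ edge p q} ->
    (forall u v : X, edge u v -> d u <= (d v).+1) ->
    (forall u v : X, 0 < d u <= k -> d u = d v -> u = v) ->
    k <= #|[set u | 0 < d u <= k]| -> (forall u, d u <= k.+1) ->
    (exists u, d u = 0) -> (exists u, d u = k.+1) ->
  ~~ connected (FS X Y).
Proof.
move=> cardI IY dE dI midk dmax [u0 du0] [u1 du1].
set mid := [set u | _] in midk.
pose left := [set u | d u == 0]; pose right := [set u | d u == k.+1].
pose l := #|left|.
have l0 : 0 < l by apply/card_gt0P; exists u0; rewrite inE du0.
have r0 : 0 < #|right| by apply/card_gt0P; exists u1; rewrite inE du1.
(* Of the [#|I| + k] places at least [k] are on the bridge, so at most [#|I|] are off it. *)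
have lr : l + #|right| <= #|I|.
  have := cardsC left; have := cardsID right (~: left).
  have -> : ~: left :&: right = right.
    by apply/setP=> u; rewrite !inE; have [->|] := eqVneq (d u) k.+1; rewrite ?andbF.
  have -> : ~: left :\: right = mid.
    by apply/setP=> u; rewrite !inE; have := dmax u; lia.
  by rewrite -/l; lia.
pose before (g : {ffun Y -> X}) j := [set z in I | d (g z) < j].
(* Members of [I] on the same side need no order: at depth 0 all belong to [J], and at depth [k.+1]
   none does, by [beforeS]. *)
pose J (g : {ffun Y -> X}) := [set y in I | #|before g (d (g y))| < l].
have beforeS (g : {ffun Y -> X}) : injective g -> l <= #|before g k.+1|.
  move=> gI; have := cardsID [set z | d (g z) < k.+1] I.
  have -> : I :&: [set z | d (g z) < k.+1] = before g k.+1.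
    by apply/setP=> z; rewrite !inE.
  suff : #|I :\: [set z | d (g z) < k.+1]| <= #|right| by lia.
  rewrite -(card_imset _ gI); apply/subset_leq_card/subsetP=> u /imsetP[z].
  by rewrite !inE => /andP[dz _] ->; have := dmax (g z); lia.
have before0 (g : {ffun Y -> X}) : #|before g 0| = 0.
  by apply/eqP; rewrite cards_eq0; apply/eqP/setP=> z; rewrite !inE andbF.
have same (g g' : {ffun Y -> X}) : {in I, forall z, d (g' z) = d (g z)} -> J g' = J g.
  move=> gg'; apply/setP=> y; rewrite !inE; case: (boolP (y \in I)) => //= yI.
  congr (_ < _); apply: eq_card => z; rewrite !inE.
  by case: (boolP (z \in I)) => //= zI; rewrite !gg'.
have up (g : {ffun Y -> X}) p q : injective g -> p \in I -> q \notin I ->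
    d (g q) = (d (g p)).+1 -> J (swap g p q) = J g.
  move=> gI pI qI dq; set g' := swap g p q.
  have g'I : injective g' by apply: swap_inj.
  have g'p : g' p = g q by rewrite ffunE tpermL.
  have g'q : g' q = g p by rewrite ffunE tpermR.
  have g'z z : z \in I -> z != p -> g' z = g z.
    move=> zI zp; rewrite ffunE tpermD // eq_sym //.
    by apply: contraTneq zI => ->.
  apply/setP=> y; rewrite !inE; case: (boolP (y \in I)) => //= yI.
  have pk : d (g p) <= k by rewrite -ltnS -dq.
  have [->|yp] := eqVneq y p.
    rewrite g'p dq; have [p0|p0] := posnP (d (g p)).
      (* When [p] leaves depth 0 its place goes to the outsider [q], so fewer than [l] members of
         [I] remain there and [p] stays in [J]. *)
      rewrite p0 before0 l0 -(card_imset _ g'I); apply: proper_card.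
      apply/properP; split.
        by apply/subsetP=> u /imsetP[z]; rewrite !inE => /andP[_ dz] ->; lia.
      exists (g p); first by rewrite inE p0.
      apply/imsetP=> -[z]; rewrite -g'q inE => /andP[zI _] /g'I qz.
      by rewrite qz zI in qI.
    (* Bridge places have distinct depths, so no other member of [I] is at the depth that [p]
       leaves. *)
    congr (_ < _); apply: eq_card => z; rewrite !inE.
    case: (boolP (z \in I)) => //= zI.
    have [->|zp] := eqVneq z p; first by rewrite g'p dq !ltnn.
    rewrite g'z // ltnS leq_eqVlt; have [e|//] := eqVneq (d (g z)) (d (g p)).
    by case/eqP: zp; apply/gI/dI; rewrite ?e ?p0.
  rewrite g'z //.
  (* Only at the depth of [q] could the count for [y] change. On the bridge that place belongs to
     [q]; on the right, [y] is outside [J] before and after. *)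
  have [yq|yq] := eqVneq (d (g y)) (d (g q)).
    have [qk|qk] := leqP (d (g q)) k.
      have yE : y = q by apply/gI/dI; rewrite yq ?qk ?dq.
      by rewrite yE (negbTE qI) in yI.
    have -> : d (g y) = k.+1 by have := dmax (g q); lia.
    by rewrite !ltnNge !beforeS.
  congr (_ < _); apply: eq_card => z; rewrite !inE.
  case: (boolP (z \in I)) => //= zI.
  have [->|zp] := eqVneq z p; last by rewrite g'z.
  by rewrite g'p; lia.
have one (g : {ffun Y -> X}) p q : injective g -> p \in I -> q \notin I ->
    edge (g p) (g q) -> J (swap g p q) = J g.
  move=> gI pI qI gpq; have gqp := gpq; rewrite edge_sym in gqp.
  have [lt|lt|e] := ltngtP (d (g p)) (d (g q)).
  - by apply: up => //; have := dE _ _ gqp; lia.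
  (* A move to the left undoes a move to the right. *)
  - rewrite -[in RHS](swapK g p q); symmetry; apply: up => //; first exact: swap_inj.
    by rewrite !ffunE tpermL tpermR; have := dE _ _ gpq; lia.
  by apply: same => z _; rewrite ffunE; case: tpermP => // ->.
have /card_gt1P[y1 [y2 [y1I y2I y12]]] : 1 < #|I| by lia.
have u01 : u0 != u1 by apply/eqP=> e; rewrite e du1 in du0.
have [g [gI gy1 gy2]] := exists_arrangement2 card_eq y12 u01.
apply: (@fs_disconnected _ _ card_eq _ J g y1 y2) => //.
  move=> f p q fI pq fpq; have [pI|pI] := boolP (p \in I).
    by apply: one => //; apply: contraL pq => qI; apply: IY.
  have [qI|qI] := boolP (q \in I); first by rewrite swapC one // edge_sym.
  by apply: same => z zI; rewrite ffunE tpermD //; apply: contraTneq zI => <-.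
(* The swap takes [y1] from depth 0, inside [J], to depth [k.+1], outside it. *)
apply/eqP=> /setP /(_ y1); rewrite !inE y1I ffunE tpermL gy1 gy2 du0 du1.
by rewrite before0 l0 ltnNge beforeS //; apply: swap_inj.
Qed.

Lemma bridge_FS (I : {set Y}) (k : nat) :
    1 < k -> #|I| + k = #|X| -> {in I &, forall p q, ~~ edge p q} ->
  has_bridge k X -> ~~ connected (FS X Y).
Proof.
move=> k1 cardI IY [s [sk sb]].
have [d [dE dI midk dmax [d0 d1]]] := bridge_depth k1 sk sb.
exact: depth_FS cardI IY dE dI midk dmax d0 d1.
Qed.

End BridgeInvariant.

(** * Complete multipartite graphs *)

Section CompleteMultipartiteFS.
Variables (t : nat) (k : t.-tuple nat) (X : sgraph).
Local Notation Y := (complete_multipartite k).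

Definition part (i : 'I_t) : {set Y} := [set y | tag y == i].

Lemma card_part i : #|part i| = tnth k i.
Proof.
have inj : injective (Tagged (fun i => 'I_(tnth k i)) (i := i)).
  by move=> x y; apply: eq_from_Tagged.
rewrite -[RHS]card_ord -(card_imset _ inj); apply: eq_card => y.
rewrite inE; apply/eqP/imsetP => [|[x _ ->] //].
by case: y => j x /= ij; subst j; exists x.
Qed.

Lemma card_complete_multipartite : #|Y| = \sum_(i < t) tnth k i.
Proof.
rewrite card_tagged sumnE big_map big_enum /=.
by apply: eq_bigr => i _; rewrite card_ord.
Qed.

Lemma part_independent i : {in part i &, forall p q : Y, ~~ edge p q}.
Proof.
move=> p q; rewrite !inE /= /multipartite_rel => /eqP -> /eqP ->.
by rewrite eqxx.
Qed.

Hypothesis card_eq : #|Y| = #|X|.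

Lemma cycle_multipartite_FS : 0 < t ->
    (exists i, 2 < tnth k i) \/ (forall i, tnth k i = 2) ->
  is_cycle X -> ~~ connected (FS X Y).
Proof.
move=> t0 [[i]|k2]; last exact: matching_cycle_FS.
rewrite -card_part => /card_gt2P[a [b [c [[ai bi ci] [ab bc ca]]]]].
apply: (@cycle_triangle_FS _ _ card_eq a b c); try exact: (@part_independent i).
by rewrite /= !inE negb_or ab bc eq_sym ca.
Qed.

Lemma bridge_multipartite_FS i m : 1 < m -> tnth k i + m = #|X| ->
  has_bridge m X -> ~~ connected (FS X Y).
Proof.
rewrite -card_part => m1 cardi.
apply: (bridge_FS card_eq m1 cardi).
exact: part_independent.
Qed.

Lemma path_multipartite_FS i : 1 < tnth k i ->
  is_path X -> ~~ connected (FS X Y).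
Proof.
rewrite -card_part => /card_gt1P[a [b [ai bi ab]]].
by apply: (path_FS card_eq ab); apply: part_independent ai bi.
Qed.

End CompleteMultipartiteFS.

Theorem theorem1p4 (t n : nat) (k : t.-tuple nat) (X : sgraph) :
  let k1 := nth 0 k 0 in
  let kt := nth 0 k t.-1 in
  2 <= t -> 1 <= k1 -> sorted leq k ->
  n = \sum_(i < t) tnth k i -> 4 <= n ->
  #|{: X}| = n ->
  [/\ (t = 2 -> 2 <= k1 ->
       [\/ ~~ connected X, bipartite X, is_cycle X | has_bridge k1 X] ->
       ~~ connected (FS X (complete_multipartite [tuple k1; n - k1]))),
      (2 < t -> 2 < kt \/ 1 < \big[gcdn/0]_(i < t) tnth k i ->
       [\/ ~~ connected X, is_cycle X | has_bridge (n - kt) X] ->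
       ~~ connected (FS X (complete_multipartite k)))
    & (2 < t -> k1 = 1 -> kt = 2 ->
       ~~ connected X \/ is_path X ->
       ~~ connected (FS X (complete_multipartite k)))].
Proof.
move=> k1 kt t2 k1_gt0 ksorted nE n4 cardX.
have t_gt0 : 0 < t by lia.
have tm1 : t.-1 < t by lia.
pose i1 := Ordinal t_gt0; pose it := Ordinal tm1.
have k1E : tnth k i1 = k1 by rewrite (tnth_nth 0).
have ktE : tnth k it = kt by rewrite (tnth_nth 0).
have nth_le i j : i <= j -> j < t -> nth 0 k i <= nth 0 k j.
  move=> ij jt; apply: (sorted_leq_nth leq_trans leqnn) => //.
    by rewrite inE size_tuple; lia.
  by rewrite inE size_tuple.
have k_ge i : k1 <= tnth k i by rewrite (tnth_nth 0) nth_le.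
have k_le i : tnth k i <= kt.
  by rewrite (tnth_nth 0) nth_le //; have := ltn_ord i; lia.
have card_eq : #|complete_multipartite k| = #|X|.
  by rewrite card_complete_multipartite -nE.
have card_gt1 : 1 < #|complete_multipartite k| by rewrite card_eq cardX; lia.
split.
- move=> te k1_gt1.
  (* With two parts, [n - k1] is [kt], and exactly [k1] people lie outside the second part. *)
  have nkt : n = k1 + kt.
    have it1 : it != i1 by apply/eqP=> /(congr1 val) /=; lia.
    rewrite nE (bigD1 i1) //= (bigD1 it) //= big1 ?addn0 ?k1E ?ktE //.
    by case=> i ilt; rewrite -!val_eqE /=; lia.
  set k' := [tuple _; _].
  have k'0 : tnth k' ord0 = k1 by [].
  have k'1 : tnth k' ord_max = kt by rewrite (tnth_nth 0) /= nkt addKn.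
  have k1kt : k1 <= kt by rewrite -ktE.
  have card_eq' : #|complete_multipartite k'| = #|X|.
    rewrite card_complete_multipartite cardX big_ord_recr /= big_ord1 k'1 nkt.
    by congr (_ + _).
  case=> [Xd|Xb|Xc|Xbr].
  + by apply: disconnected_FS => //; rewrite card_eq' cardX; lia.
  + apply: (bipartite_FS card_eq' (B := part k' ord0)) => //.
      move=> p q; rewrite !inE /= /multipartite_rel.
      by case: p q => [[[|[|//]] ?] p] [[[|[|//]] ?] q].
    by rewrite card_part.
  + apply: (cycle_multipartite_FS card_eq') => //.
    have [kt2|kt2] := ltnP 2 kt; [left; exists ord_max; rewrite k'1 // | right].
    case=> [[|[|//]] ?].
      by rewrite (tnth_nth 0) /=; lia.
    by rewrite (tnth_nth 0) /=; lia.
  by apply: (bridge_multipartite_FS card_eq' (i := ord_max) _ _ Xbr);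
    rewrite // k'1; lia.
- move=> t3 hk [Xd|Xc|Xbr].
  + exact: disconnected_FS.
  + apply: cycle_multipartite_FS => //.
    have [kt2|kt2] := ltnP 2 kt; first by left; exists it; rewrite ktE.
    case: hk => [|gcd1]; first lia.
    (* A part of size 1 would make the gcd 1; as no part exceeds 2, all are pairs. *)
    right=> i; suff : tnth k i != 1 by have := k_ge i; have := k_le i; lia.
    by apply: contraTneq gcd1 => ki; rewrite (bigD1 i) //= ki gcd1n.
  (* At least two nonempty parts remain besides the last one, so the bridge has an edge. *)
  have nkt : 1 < n - kt.
    have t1 : 1 < t by lia.
    pose i2 := Ordinal t1.
    have -> : n - kt = \sum_(i < t | i != it) tnth k i.
      by rewrite nE (bigD1 it) //= ktE addKn.
    rewrite (bigD1 i1) /=; last by rewrite -val_eqE /=; lia.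
    rewrite (bigD1 i2) /=; last by rewrite -!val_eqE /=; lia.
    by have := k_ge i1; have := k_ge i2; lia.
  apply: (bridge_multipartite_FS card_eq (i := it) nkt _ Xbr).
  by rewrite ktE cardX; lia.
move=> _ _ kt2 [Xd|Xp]; first exact: disconnected_FS.
by apply: (path_multipartite_FS card_eq (i := it)) => //; rewrite ktE kt2.
Qed.
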